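(* (1) The normalizer of $H_\lambda=\prod_{1\le i\le s}J_r(n_i)^{p_i}$ in $G=\mathrm{GL}(N)$ can be expressed as $$N_G(H_\lambda)=H_\lambda\rtimes\left(\prod_{1\le i\le s}\bigl(W_r(n_i)^{p_i}\rtimes\mathcal P_i\bigr)\right),$$ where $\mathcal P_i$ is the group, isomorphic to the symmetric group $\mathfrak S_{p_i}$, consisting of the permutation matrices $P_\sigma=(\delta_{j,\sigma(k)}\cdot 1_{n_ir})_{1\le j,k\le p_i}$ of size $p_in_ir$ with $\sigma\in\mathfrak S_{p_i}$. (2) $\mathcal P_i$ acts on $W_r(n_i)^{p_i}$ as a permutation of diagonal blocks.
   Context: Let $r,n$ be positive integers, $N=nr$, $G=\mathrm{GL}(N)=\mathrm{GL}(N,\mathbb C)$; $\mathrm{Mat}(r)$ is the set of complex $r\times r$ matrices. For a positive integer $p$, $J_r(p)\subset\mathrm{GL}(pr)$ is the group of block matrices $\sum_{0\le i<p}h_i\otimes\Lambda^i$, i.e. $p\times p$ block matrices whose $(a,b)$-block ($r\times r$) is $h_{b-a}$ if $b\ge a$ and $0$ otherwise, with $h_0\in\mathrm{GL}(r)$ and $h_1,\dots,h_{p-1}\in\mathrm{Mat}(r)$. Let $\lambda$ be a partition of $n$ written as $\lambda=(\overbrace{n_1,\dots,n_1}^{p_1},\dots,\overbrace{n_s,\dots,n_s}^{p_s})$ with $n_1>n_2>\dots>n_s>0$, $p_i\ge1$, $\sum_i p_in_i=n$. Then $H_\lambda\subset G$ is the group of block-diagonal matrices whose diagonal blocks are, in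 this order, $p_1$ elements of $J_r(n_1)$, $p_2$ elements of $J_r(n_2)$, ..., $p_s$ elements of $J_r(n_s)$. $N_G(H_\lambda)=\{g\in G\mid ghg^{-1}\in H_\lambda\ \forall h\in H_\lambda\}$. Polynomials $\mu_{i,j}$: for variables $x=(x_1,x_2,\dots)$ and integers $i,j\ge0$, $\mu_{i,j}(x)$ is defined by $(x_1T+x_2T^2+\cdots)^i=\sum_{j\ge0}\mu_{i,j}(x)T^j$ (with $0$-th power equal to $1$). For $0\le i,j<p$, $\mu_{i,j}$ involves only $x_1,\dots,x_{p-1}$. Define $$W_r(p)=\{(\mu_{i,j}(c)1_r)_{0\le i,j<p}\mid c=(c_1,\dots,c_{p-1})\in\mathbb C^{p-1},\ c_1\ne0\}\subset\mathrm{GL}(pr),$$ with $W_r(1)=\{1_r\}$. All products of groups are realized as block-diagonal subgroups: $W_r(n_i)^{p_i}$ is the group of $\mathrm{diag}(X_1,\dots,X_{p_i})\in\mathrm{GL}(p_in_ir)$ with $X_k\in W_r(n_i)$, and the product over $i$ is block diagonal in $G$. The semidirect products are internal ones in $G$ (left factor normal). The permutation action in (2) is $\mathrm{diag}(X_1,\dots,X_{p_i})\mapsto P_\sigma^{-1}\mathrm{diag}(X_1,\dots,X_{p_i})P_\sigma=\mathrm{diag}(X_{\sigma(1)},\dots,X_{\sigma(p_i)})$. *)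

(* Defs.v *)
From mathcomp Require Import all_boot all_order all_algebra all_fingroup.
From mathcomp Require Import classical_sets reals complex mxtens.
From mathcomp Require Import ring.

Set Implicit Arguments.
Unset Strict Implicit.
Unset Printing Implicit Defensive.

Import GRing.Theory.
Local Open Scope ring_scope.
Local Open Scope classical_set_scope.

Section MatrixGroups.
Variables (F : fieldType) (d : nat).
Implicit Types (A K L : set 'M[F]_d).

Definition GL : set 'M[F]_d := [set g | g \in unitmx].

Definition is_subgroup A : Prop :=
  [/\ A `<=` GL, A 1%:M,
      forall x y, A x -> A y -> A (x *m y) &
      forall x, A x -> A (invmx x)].

Definition normalizer A : set 'M[F]_d :=
  [set g | GL g /\ forall h, A h -> A (g *m h *m invmx g)].

Definition mulset K L : set 'M[F]_d :=
  [set g | exists k l, [/\ K k, L l & g = k *m l]].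

Definition is_normal K A : Prop :=
  [/\ is_subgroup K, is_subgroup A, K `<=` A & A `<=` normalizer K].

(* A is the internal semidirect product of its subgroups K (normal) and L. *)
Definition is_sdprod A K L : Prop :=
  [/\ is_normal K A, is_subgroup L, K `&` L = [set 1%:M] & A = mulset K L].

Definition isomorphic_to_Sym (q : nat) A : Prop :=
  exists f : 'S_q -> 'M[F]_d,
    [/\ injective f, forall s t, f (s * t)%g = f s *m f t & range f = A].

End MatrixGroups.
Arguments GL {F d}.

Definition diag_prod (F : fieldType) (q : nat) (d : 'I_q -> nat)
    (S : forall k, set 'M[F]_(d k)) : set 'M[F]_(\sum_k d k) :=
  [set A | exists2 X : forall k, 'M[F]_(d k),
             (forall k, S k (X k)) & A = \mxdiag_k X k].

Definition diag_pow (F : fieldType) (d q : nat) (S : set 'M[F]_d) :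
    set 'M[F]_(\sum_(k < q) d) :=
  diag_prod (fun _ : 'I_q => S).
Arguments diag_pow {F d} q S.

Section Blocks.
Variable F : fieldType.

Definition shift_mx (p : nat) : 'M[F]_p := \matrix_(a, b) (b == a.+1 :> nat)%:R.

(* In tensmx the left factor indexes the blocks, so the matrix with r x r
   blocks usually written h (x) Lambda^i is Lambda^i *t h. *)
Definition toeplitz_mx (r p : nat) (h : nat -> 'M[F]_r) : 'M[F]_(p * r) :=
  \sum_(i < p) shift_mx p ^+ i *t h i.

Definition Jgrp (r p : nat) : set 'M[F]_(p * r) :=
  [set A | exists2 h : nat -> 'M[F]_r, h 0 \in unitmx & A = toeplitz_mx p h].

(* The monomials of degree > j do not contribute to the coefficient of T^j, so
   the power series x_1 T + x_2 T^2 + ... is cut off after T^j; the value x 0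
   is not used. *)
Definition mu (x : nat -> F) (i j : nat) : F :=
  ((\sum_(1 <= k < j.+1) x k *: 'X^k) ^+ i)`_j.

Definition mu_mx (p : nat) (c : nat -> F) : 'M[F]_p := \matrix_(i, j) mu c i j.

(* Only c 1, ..., c p.-1 occur in mu_mx p c; for p = 1 the condition on c 1 is
   harmless, see Wgrp1. *)
Definition Wgrp (r p : nat) : set 'M[F]_(p * r) :=
  [set A | exists2 c : nat -> F, c 1 != 0 & A = mu_mx p c *t (1%:M : 'M_r)].

Definition block_perm_mx (d q : nat) (s : 'S_q) : 'M[F]_(\sum_(k < q) d) :=
  \mxblock_(j < q, k < q) ((j == s k)%:R%:M : 'M_d).

Definition block_perms (d q : nat) : set 'M[F]_(\sum_(k < q) d) :=
  range (@block_perm_mx d q).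

End Blocks.
Arguments Jgrp F r p : clear implicits.
Arguments Wgrp F r p : clear implicits.
Arguments block_perms F d q : clear implicits.

(* A partition of n in the form (n_1^p_1, ..., n_s^p_s), n_1 > ... > n_s > 0. *)
Record partition_of (n : nat) := PartitionOf {
  nparts : nat;
  part : 'I_nparts -> nat;
  mult : 'I_nparts -> nat;
  part_decr : forall i j : 'I_nparts, (i < j)%N -> (part j < part i)%N;
  part_gt0 : forall i, (0 < part i)%N;
  mult_gt0 : forall i, (0 < mult i)%N;
  sum_parts : (\sum_i mult i * part i = n)%N }.
Arguments part {n} p _.
Arguments mult {n} p _.

Lemma partition_size (n : nat) (la : partition_of n) (r : nat) :
  (\sum_(i < nparts la) \sum_(k < mult la i) part la i * r = n * r)%N.
Proof.
rewrite -[in RHS](sum_parts la) big_distrl /=; apply: eq_bigr => i _.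
by rewrite sum_nat_const card_ord mulnA.
Qed.

Section PartitionGroups.
Variables (F : fieldType) (r n : nat) (la : partition_of n).

(* The block-diagonal product over the distinct parts, placed inside GL(n r). *)
Definition la_prod
    (S : forall i, set 'M[F]_(\sum_(k < mult la i) part la i * r)) :
    set 'M[F]_(n * r) :=
  [set castmx (partition_size la r, partition_size la r) A | A in diag_prod S].

Definition Hgrp : set 'M[F]_(n * r) :=
  la_prod (fun i => diag_pow (mult la i) (Jgrp F r (part la i))).

Definition Wpow (i : 'I_(nparts la)) :
    set 'M[F]_(\sum_(k < mult la i) part la i * r) :=
  diag_pow (mult la i) (Wgrp F r (part la i)).
Arguments Wpow : clear implicits.

Definition Pgrp (i : 'I_(nparts la)) :
    set 'M[F]_(\sum_(k < mult la i) part la i * r) :=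
  block_perms F (part la i * r) (mult la i).
Arguments Pgrp : clear implicits.

Definition Hcompl : set 'M[F]_(n * r) :=
  la_prod (fun i => mulset (Wpow i) (Pgrp i)).

End PartitionGroups.
Arguments Hgrp F r {n} la.
Arguments Wpow F r {n} la i.
Arguments Pgrp F r {n} la i.
Arguments Hcompl F r {n} la.

Section Facts.
Variable F : fieldType.

Lemma mu_trunc (x : nat -> F) (i j d : nat) : (j <= d)%N ->
  mu x i j = ((\sum_(1 <= k < d.+1) x k *: 'X^k) ^+ i)`_j.
Proof.
rewrite /mu => jd.
rewrite [in RHS](@big_cat_nat _ _ _ j.+1) //=.
set a := \sum_(1 <= k < j.+1) _; set b := \sum_(_ <= k < _) _.
have [q ->] : exists q, b = q * 'X^(j.+1).
  exists (\sum_(j.+1 <= k < d.+1) x k *: 'X^(k - j.+1)).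
  rewrite /b mulr_suml; apply: eq_big_nat => k /andP[jk _].
  by rewrite -scalerAl -exprD subnK.
have [t ->] : exists t, (a + q * 'X^(j.+1)) ^+ i = a ^+ i + t * 'X^(j.+1).
  elim: i => [|i [t IH]]; first by exists 0; rewrite !expr0 mul0r addr0.
  exists (t * a + a ^+ i * q + t * 'X^(j.+1) * q).
  by rewrite exprSr IH [a ^+ i.+1]exprSr; move: ('X^(j.+1)) (a ^+ i) => y z; ring.
by rewrite coefD coefMXn ltnSn addr0.
Qed.

Lemma Wgrp1 (r : nat) : Wgrp F r 1 = [set 1%:M].
Proof.
have E c : mu_mx 1 c *t (1%:M : 'M[F]_r) = 1%:M.
  have -> : mu_mx 1 c = 1%:M :> 'M[F]_1.
    by apply/matrixP => i j; rewrite !mxE !ord1 /mu expr0 coef1.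
  apply/matrixP => i j; rewrite -(mxtens_unindexK i) -(mxtens_unindexK j).
  case: (mxtens_unindex i) (mxtens_unindex j) => [i0 i1] [j0 j1].
  by rewrite tensmxE !mxE !ord1 mul1r (can_eq (@mxtens_indexK 1 r)).
apply/seteqP; split => A /=; first by case=> c _ ->.
by move=> ->; exists (fun=> 1); rewrite ?E ?oner_eq0.
Qed.

Lemma shift_mxX (p i : nat) (a b : 'I_p) :
  (shift_mx F p ^+ i) a b = (b == (a + i)%N :> nat)%:R.
Proof.
elim: i a => [|i IH] a; first by rewrite expr0 mxE addn0 eq_sym.
rewrite exprS mxE.
have [ap|pa] := ltnP a.+1 p.
  rewrite (bigD1 (Ordinal ap)) //= mxE eqxx mul1r IH addSnnS big1 ?addr0 //.
  by move=> k /negPf; rewrite mxE -val_eqE /= => ->; rewrite mul0r.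
rewrite big1 => [|k _].
  case: eqP => // E; have := ltn_ord b; rewrite E addnS ltnNge.
  by rewrite (leq_trans pa) // ltnS leq_addr.
rewrite mxE; case: eqP => [E|]; last by rewrite mul0r.
by have := ltn_ord k; rewrite E ltnNge pa.
Qed.

Lemma toeplitz_mxE (r p : nat) (h : nat -> 'M[F]_r) (a b : 'I_p) (u v : 'I_r) :
  toeplitz_mx p h (mxtens_index (a, u)) (mxtens_index (b, v)) =
  if (a <= b)%N then h (b - a)%N u v else 0.
Proof.
rewrite summxE; under eq_bigr do rewrite tensmxE shift_mxX.
case: leqP => ab.
  have lt : (b - a < p)%N by rewrite (leq_ltn_trans (leq_subr _ _)).
  rewrite (bigD1 (Ordinal lt)) //= subnKC // eqxx mul1r big1 ?addr0 // => k.
  rewrite -val_eqE /= => /negPf kab; case: eqP => [E|]; last by rewrite mul0r.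
  by rewrite E addKn eqxx in kab.
rewrite big1 // => k _; case: eqP => [E|]; last by rewrite mul0r.
by move: ab; rewrite E ltnNge leq_addr.
Qed.

End Facts.

(* Main.v *)
(* H_lambda is the group of units of the centralizer of one matrix z, block
   diagonal with blocks (a_k + Lambda) (x) 1_r where the scalars a_k are
   distinct. If g normalizes H_lambda, conjugation by g preserves the
   centralizer C(z), which is spanned by units; comparing dimensions it is onto,
   so g z g^-1 lies in the centre of C(z) and is block diagonal with blocks
   (c_k0 + c_k1 Lambda + ...) (x) 1_r. Each of these has a single eigenvalue, so
   the intertwiner g has one nonzero block in each block row and column: up to a
   permutation of blocks of equal size it is block diagonal. On one block,
   g^-1 (Lambda (x) 1) g = c(Lambda) (x) 1 with c(T) = c_1 T + ..., c_1 <> 0; the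
   substitution matrix w = (mu_ij(c)) satisfies Lambda w = w c(Lambda), so
   g (w (x) 1)^-1 commutes with Lambda (x) 1, that is, lies in J_r(p). The same
   circle of ideas describes W_r(p) as those w (x) 1 in the normalizer of J_r(p)
   for which w has first row (1, 0, ..., 0), which makes it a group. *)

Require Import Defs.
From mathcomp Require Import all_boot all_order all_algebra all_fingroup.
From mathcomp Require Import classical_sets reals complex mxtens.
From mathcomp Require Import ring.

Set Implicit Arguments.
Unset Strict Implicit.
Unset Printing Implicit Defensive.

Import GRing.Theory.
Local Open Scope ring_scope.
Local Open Scope classical_set_scope.

(** * Normalizers and centralizers *)

Section Subgroups.
Variables (F : fieldType) (d : nat).
Implicit Types (K L : set 'M[F]_d) (g h : 'M[F]_d).

Lemma normalizer1 K : normalizer K 1%:M.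
Proof.
split; first exact: unitmx1.
by move=> h Kh; rewrite invmx1 mul1mx mulmx1.
Qed.

Lemma invmxM g h : g \in unitmx -> h \in unitmx ->
  invmx (g *m h) = invmx h *m invmx g.
Proof.
move=> ug uh; rewrite -[RHS]mulmx1 -(@mulmxV _ _ (g *m h)) ?unitmx_mul ?ug //.
by rewrite !mulmxA mulmxKV // mulVmx // mul1mx.
Qed.

Lemma normalizerM K g h : normalizer K g -> normalizer K h ->
  normalizer K (g *m h).
Proof.
move=> [ug Ng] [uh Nh]; split; first by rewrite /GL /= unitmx_mul ug.
by move=> k /Nh /Ng; rewrite invmxM // !mulmxA.
Qed.

Lemma subgroup_normalizer K : is_subgroup K -> K `<=` normalizer K.
Proof.
move=> [sK _ KM KV] g Kg; split; first exact: sK.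
by move=> h Kh; apply: (KM _ _ (KM _ _ Kg Kh)); apply: KV.
Qed.

Lemma mulset_subgroup K L : is_subgroup K -> is_subgroup L ->
  L `<=` normalizer K -> is_subgroup (mulset K L).
Proof.
move=> [sK K1 KM KV] [sL L1 LM LV] LN; split.
- by move=> _ [k [l [/sK uk /sL ul ->]]]; rewrite /GL /= unitmx_mul; apply/andP.
- by exists 1%:M, 1%:M; rewrite mulmx1.
- move=> _ _ [k [l [Kk Ll ->]]] [k' [l' [Kk' Ll' ->]]].
  exists (k *m (l *m k' *m invmx l)), (l *m l'); split.
  + by apply: KM => //; apply: (LN _ Ll).2.
  + exact: LM.
  + by rewrite !mulmxA mulmxKV //; apply: sL.
- move=> _ [k [l [Kk Ll ->]]].
  exists (invmx l *m invmx k *m invmx (invmx l)), (invmx l); split.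
  + by apply: (LN _ (LV _ Ll)).2; apply: KV.
  + exact: LV.
  + by rewrite mulmxKV ?unitmx_inv ?invmxM //; [apply: sK | apply: sL | apply: sL].
Qed.

(** Every semidirect product below comes from this criterion; what remains each time is to identify
    the group with a product set. *)
Lemma mulset_sdprod K L : is_subgroup K -> is_subgroup L ->
  L `<=` normalizer K -> K `&` L = [set 1%:M] -> is_sdprod (mulset K L) K L.
Proof.
move=> gK gL LN KL1; have [_ K1 _ _] := gK; have [_ L1 _ _] := gL.
split=> //; split=> //; first exact: mulset_subgroup.
  by move=> k Kk; exists k, 1%:M; rewrite mulmx1.
move=> _ [k [l [Kk Ll ->]]]; apply: normalizerM; last exact: LN.
exact: subgroup_normalizer.
Qed.

End Subgroups.

Section Centralizers.
Variables (F : fieldType) (d : nat).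
Hypothesis natF_inj : injective (fun k : nat => k%:R : F).
Implicit Types g x y z : 'M[F]_d.

Definition comm_units z : set 'M[F]_d :=
  [set g | g \in unitmx /\ comm_mx g z].

Lemma comm_mxV z g : g \in unitmx -> comm_mx g z -> comm_mx (invmx g) z.
Proof.
move=> ug gz; rewrite /comm_mx -[z in LHS]mulmx1 -(mulmxV ug) !mulmxA.
by rewrite -(mulmxA _ z) -gz mulmxA mulVmx // mul1mx.
Qed.

Lemma comm_units_subgroup z : is_subgroup (comm_units z).
Proof.
split.
- by move=> g [].
- by split; [exact: unitmx1 | exact: comm1mx].
- move=> g h [ug gz] [uh hz]; split; first by rewrite unitmx_mul ug.
  exact/comm_mx_sym/comm_mxM; exact: comm_mx_sym.
- by move=> g [ug gz]; split; [rewrite unitmx_inv | exact: comm_mxV].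
Qed.

(** The characteristic polynomial has fewer roots than its size, and [natF_inj] supplies that many
    distinct scalars; the opposite of a non-root works. Hence a centralizer is spanned by its
    units. *)
Lemma shift_unitmx x : exists c : F, x + c%:M \in unitmx.
Proof.
pose p := char_poly x; pose s : seq F := [seq k%:R | k <- iota 0 (size p)].
have us : uniq s by rewrite map_inj_uniq ?iota_uniq.
have /allPn[c _ nc] : ~~ all (root p) s.
  apply/negP => /max_poly_roots -/(_ (monic_neq0 (char_poly_monic x)) us).
  by rewrite size_map size_iota ltnn.
exists (- c); move: nc; rewrite -eigenvalue_root_char /eigenvalue /eigenspace.
by rewrite negbK kermx_eq0 row_free_unit raddfN.
Qed.

Lemma comm_conj x y g : g \in unitmx ->
  comm_mx (g *m x *m invmx g) (g *m y *m invmx g) <-> comm_mx x y.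
Proof.
move=> ug; have E a b : g *m a *m invmx g *m (g *m b *m invmx g) =
    g *m (a *m b) *m invmx g by rewrite !mulmxA mulmxKV.
rewrite /comm_mx !E; split=> [|-> //].
move/(congr1 (fun u => invmx g *m u *m g)).
by rewrite !mulmxA !mulmxKV // !mulVmx // !mul1mx.
Qed.

(* Conjugation by g maps the full centralizer of z into itself because that
   centralizer is spanned by units, and onto itself by comparing dimensions. *)
Lemma normalizer_comm_units z g : normalizer (comm_units z) g ->
  forall y, comm_mx y z -> comm_mx y (g *m z *m invmx g).
Proof.
move=> [ug Ng].
pose C := lker (linfun (mulmxr z \- mulmx z)).
pose phi := linfun (mulmxr (invmx g) \o mulmx g).
have CP y : reflect (comm_mx y z) (y \in C).
  by rewrite memv_ker lfunE /= subr_eq0; apply: eqP.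
have phiE x : phi x = g *m x *m invmx g by rewrite lfunE.
have phiC : (phi @: C <= C)%VS.
  apply/subvP => _ /memv_imgP[x /CP xz ->]; apply/CP; rewrite phiE.
  (* Conjugation fixes scalars: [c] is added to reach a unit and removed after conjugating. *)
  have [c uxc] := shift_unitmx x.
  have [] := Ng (x + c%:M).
    split=> //; apply/comm_mx_sym/comm_mxD; first exact: comm_mx_sym.
    exact: comm_mx_scalar.
  move=> _; rewrite mulmxDr mulmxDl scalar_mxC mulmxK // => xcz.
  rewrite -[_ *m _](addrK c%:M); apply: comm_mx_sym; apply: comm_mxB.
    exact: comm_mx_sym.
  exact: comm_mx_scalar.
have phi0 : lker phi = 0%VS.
  apply/eqP/lker0P => x y; rewrite !phiE => /(congr1 (fun u => invmx g *m u *m g)).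
  by rewrite !mulmxA !mulmxKV // !mulVmx // !mul1mx.
have phiCE : (phi @: C)%VS = C.
  by apply/eqP; rewrite eqEdim phiC limg_dim_eq ?leqnn // phi0 capv0.
move=> y /CP; rewrite -phiCE => /memv_imgP[x /CP xz ->].
by rewrite phiE; apply/comm_conj.
Qed.

(** [normalizer] asks only for an inclusion, so stability under inversion is not formal: it rests on
    conjugation mapping the centralizer onto itself. *)
Lemma normalizer_comm_unitsV z g : normalizer (comm_units z) g ->
  normalizer (comm_units z) (invmx g).
Proof.
move=> Ng; have [ug _] := Ng; split; first by rewrite /GL /= unitmx_inv.
move=> h [uh hz]; split; first by rewrite !unitmx_mul !unitmx_inv ug uh.
rewrite invmxK -(comm_conj _ _ ug) !mulmxA mulmxK // mulmxV // mul1mx.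
exact: normalizer_comm_units.
Qed.

Lemma normalizer_comm_units_subgroup z :
  is_subgroup (normalizer (comm_units z)).
Proof.
split; [by move=> g [] | exact: normalizer1 | | exact: normalizer_comm_unitsV].
by move=> g h; apply: normalizerM.
Qed.

End Centralizers.

(** * Toeplitz matrices and their centralizers *)

Lemma dvd_Xn_coef (R : nzRingType) (m : nat) (f : {poly R}) :
  (forall i, (i < m)%N -> f`_i = 0) -> exists q, f = q * 'X^m.
Proof.
move=> f0; exists (drop_poly m f).
rewrite -[LHS](poly_take_drop m); suff -> : take_poly m f = 0 by rewrite add0r.
by apply/polyP => i; rewrite coef_take_poly coef0; case: ifP => // /f0.
Qed.

Section Toeplitz.
Variables (F : fieldType) (p : nat).
Implicit Types f g : {poly F}.

(* The matrix of multiplication by f on F[T]/(T^p), in the basis of the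
   monomials and acting on row vectors. *)
Definition toep f : 'M[F]_p := \matrix_(a, b) ('X^a * f)`_b.

Lemma sum_coef_toep f g (j : 'I_p) :
  \sum_(k < p) f`_k * toep g k j = (f * g)`_j.
Proof.
rewrite coefM (big_ord_widen p (fun k => f`_k * g`_(j - k))) //.
rewrite [in RHS]big_mkcond /=.
apply: eq_bigr => k _; rewrite mxE coefXnM ltnS.
by case: ltnP; rewrite ?mulr0.
Qed.

Lemma toepM f g : toep f *m toep g = toep (f * g).
Proof.
apply/matrixP => a b; rewrite [LHS]mxE [RHS]mxE mulrA -sum_coef_toep.
by apply: eq_bigr => k _; rewrite [toep f a k]mxE.
Qed.

Lemma toep_comm f g : comm_mx (toep f) (toep g).
Proof. by rewrite /comm_mx !toepM mulrC. Qed.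

Lemma toep_inj f g : toep f = toep g <-> forall i, (i < p)%N -> f`_i = g`_i.
Proof.
split=> [+ i ip | E].
  have p0 : (0 < p)%N := leq_ltn_trans (leq0n i) ip.
  by move/matrixP/(_ (Ordinal p0) (Ordinal ip)); rewrite !mxE !expr0 !mul1r.
apply/matrixP => a b; rewrite !mxE !coefXnM; case: ltnP => // ab.
by rewrite E // (leq_ltn_trans (leq_subr _ _)).
Qed.

Lemma toepC (c : F) : toep c%:P = c%:M.
Proof.
apply/matrixP => a b; rewrite !mxE mulrC coefCM coefXn eq_sym val_eqE.
by case: eqP; rewrite (mulr1, mulr0).
Qed.

Lemma toepMXn_eq0 f m : (p <= m)%N -> toep (f * 'X^m) = 0.
Proof.
move=> pm; apply/matrixP => a b; rewrite !mxE mulrA coefMXn.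
by rewrite (leq_trans (ltn_ord b) pm).
Qed.

Lemma shift_toep : shift_mx F p = toep 'X.
Proof. by apply/matrixP => a b; rewrite !mxE -exprSr coefXn. Qed.

Lemma shift_mulE m (w : 'M[F]_(p, m)) (a a' : 'I_p) b : a' = a.+1 :> nat ->
  (shift_mx F p *m w) a b = w a' b.
Proof.
move=> E; rewrite mxE (bigD1 a') //= mxE E eqxx mul1r big1 ?addr0 // => k.
by rewrite -val_eqE mxE /= E => /negPf ->; rewrite mul0r.
Qed.

End Toeplitz.
Arguments toep {F} p f.

(** Multiplying by Lambda on the left shifts rows up, so each row of [w], read as a polynomial, is
    the preceding one times [f] modulo T^(p+1). Row 0 thus determines [w]. *)
Lemma shift_intertwine (F : fieldType) (p : nat) (w : 'M[F]_p.+1) (f : {poly F}) :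
  shift_mx F p.+1 *m w = w *m toep p.+1 f ->
  forall a b, w a b = (rVpoly (row 0 w) * f ^+ a)`_b.
Proof.
move=> E [a ap] b /=; elim: a ap b => [|a IH] ap b.
  rewrite expr0 mulr1 coef_rVpoly_ord mxE; congr (w _ _); exact: val_inj.
rewrite -(@shift_mulE _ _ _ w (Ordinal (ltnW ap)) (Ordinal ap)) // E exprSr mulrA.
by rewrite -sum_coef_toep mxE; apply: eq_bigr => k _; rewrite IH.
Qed.

(** * Block matrices cut into matrices of scalars *)

Section Slices.
Variables (F : fieldType) (p r : nat).
Implicit Types (X Y : 'M[F]_(p * r)) (w : 'M[F]_p) (u v : 'I_r).

(** Fixing the positions inside the r x r blocks makes multiplication by w (x) 1 act on each slice
    separately, which reduces questions about Lambda (x) 1 to Lambda. *)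
Definition slice u v X : 'M[F]_p :=
  \matrix_(a, b) X (mxtens_index (a, u)) (mxtens_index (b, v)).

Lemma slice_inj X Y : (forall u v, slice u v X = slice u v Y) -> X = Y.
Proof.
move=> E; apply/matrixP => i j; case: (mxtens_indexP i) => a u.
by case: (mxtens_indexP j) => b v; have /matrixP/(_ a b) := E u v; rewrite !mxE.
Qed.

Lemma sum_mxtens (V : nmodType) (G : 'I_(p * r) -> V) :
  \sum_k G k = \sum_(a < p) \sum_(u < r) G (mxtens_index (a, u)).
Proof.
rewrite pair_big /= (reindex (@mxtens_index p r)) /=.
  by apply: eq_bigr => -[].
by exists (@mxtens_unindex p r) => k _; rewrite (mxtens_indexK, mxtens_unindexK).
Qed.

Lemma slice_tens_mul w (B : 'M[F]_r) X u v :
  slice u v ((w *t B) *m X) = \sum_t B u t *: (w *m slice t v X).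
Proof.
apply/matrixP => a b; rewrite summxE !mxE sum_mxtens exchange_big /=.
apply: eq_bigr => t _; rewrite !mxE big_distrr; apply: eq_bigr => k _ /=.
by rewrite tensmxE [slice _ _ _ _ _]mxE; ring.
Qed.

Lemma slice_mul_tens w (B : 'M[F]_r) X u v :
  slice u v (X *m (w *t B)) = \sum_t B t v *: (slice u t X *m w).
Proof.
apply/matrixP => a b; rewrite summxE !mxE sum_mxtens exchange_big /=.
apply: eq_bigr => t _; rewrite !mxE big_distrr; apply: eq_bigr => k _ /=.
by rewrite tensmxE [slice _ _ _ _ _]mxE; ring.
Qed.

Lemma slice_tens1_mul w X u v : slice u v ((w *t 1%:M) *m X) = w *m slice u v X.
Proof.
rewrite slice_tens_mul (bigD1 u) //= mxE eqxx scale1r big1 ?addr0 // => t.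
by rewrite mxE eq_sym => /negPf ->; rewrite scale0r.
Qed.

Lemma slice_mul_tens1 w X u v : slice u v (X *m (w *t 1%:M)) = slice u v X *m w.
Proof.
rewrite slice_mul_tens (bigD1 v) //= mxE eqxx scale1r big1 ?addr0 // => t.
by rewrite mxE => /negPf ->; rewrite scale0r.
Qed.

Lemma slice_tens1 w u v : slice u v (w *t 1%:M) = (u == v)%:R *: w.
Proof. by apply/matrixP => a b; rewrite !mxE !mxtens_indexK mulrC. Qed.

Lemma tens1_inj w w' : (0 < r)%N -> w *t (1%:M : 'M_r) = w' *t 1%:M -> w = w'.
Proof.
move=> r0 /(congr1 (slice (Ordinal r0) (Ordinal r0))).
by rewrite !slice_tens1 eqxx !scale1r.
Qed.

Lemma tens1C (c : F) : (c%:M : 'M_p) *t (1%:M : 'M_r) = c%:M.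
Proof.
apply: slice_inj => u v; rewrite slice_tens1; apply/matrixP => a b; rewrite !mxE.
rewrite (can_eq (@mxtens_indexK p r)) xpair_eqE.
by case: (a == b); case: (u == v); rewrite ?mul1r ?mul0r ?mulr0.
Qed.

Lemma tens1M w w' :
  (w *t (1%:M : 'M_r)) *m (w' *t 1%:M) = (w *m w') *t (1%:M : 'M_r).
Proof. by rewrite tensmx_mul mulmx1. Qed.

Lemma tens_toep_expn f k :
  (toep p f *t (1%:M : 'M[F]_r)) ^+ k = toep p (f ^+ k) *t 1%:M.
Proof.
elim: k => [|k IH]; first by rewrite !expr0 -[X in toep _ X]polyC1 toepC tens1C.
by rewrite exprS IH -mulmxE tens1M toepM -exprS.
Qed.

(** Without its constant term the polynomial is a multiple of T, so its p-th power vanishes modulo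
    T^p. Such a matrix has no eigenvalue besides f_0. *)
Lemma tens_toep_nilp f :
  (toep p f *t (1%:M : 'M[F]_r) - (f`_0)%:M) ^+ p = 0.
Proof.
have -> : toep p f *t (1%:M : 'M[F]_r) - (f`_0)%:M =
    toep p (f - (f`_0)%:P) *t 1%:M.
  rewrite -tens1C -toepC; apply: slice_inj => u v; apply/matrixP => a b.
  rewrite !mxE !mxtens_indexK /= -mulrBl; congr (_ * _).
  by rewrite mulrBr coefB.
have [|q Eq] := @dvd_Xn_coef _ 1 (f - (f`_0)%:P).
  by case=> // _; rewrite coefB coefC subrr.
by rewrite Eq tens_toep_expn exprMn expr1 toepMXn_eq0 // tens0mx.
Qed.

Lemma comm_tens1 w X :
  comm_mx X (w *t 1%:M) <-> forall u v, comm_mx (slice u v X) w.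
Proof.
split=> [E u v | E].
  by rewrite /comm_mx -slice_mul_tens1 E slice_tens1_mul.
by apply: slice_inj => u v; rewrite slice_mul_tens1 slice_tens1_mul; apply: E.
Qed.

End Slices.

(** * Centralizer and double centralizer of the shift *)

Section ShiftCentralizer.
Variables (F : fieldType) (p r : nat).
Local Notation S := (shift_mx F p.+1 *t (1%:M : 'M[F]_r)).
Implicit Types X Y : 'M[F]_(p.+1 * r).

Lemma comm_shiftP (w : 'M[F]_p.+1) :
  comm_mx w (shift_mx F p.+1) <-> exists f, w = toep p.+1 f.
Proof.
split=> [wS | [f ->]]; last by rewrite shift_toep; apply: toep_comm.
exists (rVpoly (row 0 w)); apply/matrixP => a b.
rewrite [LHS](@shift_intertwine _ _ _ 'X); first by rewrite mxE mulrC.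
by rewrite -shift_toep wS.
Qed.

Lemma comm_shift_toep X f : comm_mx X S -> comm_mx X (toep p.+1 f *t 1%:M).
Proof.
move/comm_tens1 => XS; apply/comm_tens1 => u v.
by have /comm_shiftP[g ->] := XS u v; apply: toep_comm.
Qed.

Lemma tens_toep_comm f (B : 'M[F]_r) : comm_mx (toep p.+1 f *t B) S.
Proof. by rewrite /comm_mx !tensmx_mul shift_toep toep_comm mulmx1 mul1mx. Qed.

(** Commuting with Lambda (x) 1 makes the slices polynomials in Lambda; commuting with 1 (x) B for
    all B leaves one polynomial times the identity. *)
Lemma shift_bicentralizer X : (0 < r)%N ->
  (forall Y, comm_mx Y S -> comm_mx Y X) -> exists f, X = toep p.+1 f *t 1%:M.
Proof.
move=> r0 cX; pose o := Ordinal r0.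
have XS : comm_mx X S by apply/comm_mx_sym/cX/comm_mx_refl.
have /comm_shiftP[f Ef] : comm_mx (slice o o X) (shift_mx F p.+1).
  by move/comm_tens1: XS.
exists f; rewrite -Ef; apply: slice_inj => u v; rewrite slice_tens1.
(* Testing on the matrix unit at (v, o) and reading slice (u, o) shows that slice (u, v) is slice
   (o, o) if u = v, and 0 otherwise. *)
have /(congr1 (slice u o)) : comm_mx ((1%:M : 'M_p.+1) *t delta_mx v o) X.
  by apply: cX; rewrite -[1%:M]toepC; apply: tens_toep_comm.
rewrite slice_tens_mul slice_mul_tens => E.
have {E} : \sum_t delta_mx v o u t *: slice t o X =
           \sum_t delta_mx v o t o *: slice u t X :> 'M[F]_p.+1.
  move: E; under eq_bigr do rewrite mul1mx.
  by under [in RHS]eq_bigr do rewrite mulmx1.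
rewrite (bigD1 o) //= [in X in _ = X](bigD1 v) //= !mxE !eqxx !andbT scale1r.
rewrite !big1 ?addr0 => [<- //|t /negPf tv|t /negPf to];
  by rewrite mxE ?tv ?to ?andbF scale0r.
Qed.

Lemma toeplitz_comm (h : nat -> 'M[F]_r) : comm_mx (toeplitz_mx p.+1 h) S.
Proof.
apply/comm_mx_sym/comm_mx_sum => i _; apply: comm_mx_sym.
rewrite /comm_mx !tensmx_mul mulmx1 mul1mx; congr (_ *t _).
by rewrite mulmxE -exprS -exprSr.
Qed.

Lemma comm_toeplitz X : comm_mx X S -> exists h, X = toeplitz_mx p.+1 h.
Proof.
(* The blocks h_i are read off block row 0; [inord] is faithful for all i <= p, the range that
   enters. *)
move/comm_tens1 => XS; exists (fun i => \matrix_(u, v) slice u v X 0 (inord i)).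
apply/matrixP => i j; case: (mxtens_indexP i) => a u.
case: (mxtens_indexP j) => b v.
rewrite toeplitz_mxE mxE; have /comm_shiftP[f Ef] := XS u v.
have -> : X (mxtens_index (a, u)) (mxtens_index (b, v)) = slice u v X a b.
  by rewrite mxE.
rewrite Ef !mxE coefXnM expr0 mul1r inordK ?ltnS.
  by case: leqP.
by rewrite (leq_trans (leq_subr _ _)) // -ltnS.
Qed.

Lemma unitmx_addr_nilp d (N : 'M[F]_d) k : N ^+ k = 0 -> 1%:M + N \in unitmx.
Proof.
move=> Nk.
suff /mulmx1_unit[] : (1%:M + N) *m (\sum_(i < k) (- N) ^+ i) = 1%:M by [].
rewrite -[1%:M + N]opprK opprD addrC mulNmx mulmxE -[1%:M]/(1 : 'M_d).
by rewrite -subrX1 exprNn Nk mulr0 sub0r opprK.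
Qed.

Lemma toeplitz_unit (h : nat -> 'M[F]_r) :
  (toeplitz_mx p.+1 h \in unitmx) = (h 0 \in unitmx).
Proof.
apply/idP/idP => [uT | u0].
  (* The inverse also commutes with the shift, hence is Toeplitz, and the (0, 0) blocks multiply. *)
  have [k Ek] : exists k, invmx (toeplitz_mx p.+1 h) = toeplitz_mx p.+1 k.
    by apply/comm_toeplitz/comm_mxV => //; apply: toeplitz_comm.
  suff /mulmx1_unit[] : h 0 *m k 0 = 1%:M by [].
  have := mulmxV uT; rewrite Ek => /matrixP E; apply/matrixP => u v.
  have := E (mxtens_index (0, u)) (mxtens_index (0, v)).
  rewrite mxE [in RHS]mxE (can_eq (@mxtens_indexK _ _)) xpair_eqE eqxx /= => E0.
  rewrite [RHS]mxE -E0 sum_mxtens (bigD1 0) //= [X in _ + X]big1 ?addr0 => [|a a0].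
    by rewrite mxE; apply: eq_bigr => t _; rewrite !toeplitz_mxE.
  rewrite -val_eqE /= in a0; rewrite big1 // => t _.
  by rewrite [X in _ * X]toeplitz_mxE leqn0 (negPf a0) mulr0.
(* Factor out h_0: what remains is 1 + S Y, where S is nilpotent and commutes with the Toeplitz
   matrix [Y]. *)
pose Y := toeplitz_mx p.+1 (fun i => invmx (h 0) *m h i.+1).
have -> : toeplitz_mx p.+1 h = ((1%:M : 'M_p.+1) *t h 0) *m (1%:M + S *m Y).
  rewrite mulmxDr mulmx1 [LHS]big_ord_recl expr0; congr (_ + _).
  rewrite /Y /toeplitz_mx big_ord_recr /= !mulmxDr !mulmx_sumr.
  (* The last term of [Y] meets Lambda^(p+1) = 0. *)
  rewrite [X in _ = _ + X](_ : _ = 0) ?addr0; last first.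
    rewrite !tensmx_mul mulmxE -exprS.
    suff -> : shift_mx F p.+1 ^+ p.+1 = 0 :> 'M_p.+1.
      by rewrite mulr0 tens0mx.
    apply/matrixP => a b; rewrite shift_mxX mxE; case: eqP => // E.
    by have := ltn_ord b; rewrite E addnC ltnNge leq_addr.
  apply: eq_bigr => i _; rewrite !tensmx_mul !mul1mx mulmxA mulmxV // mul1mx.
  by rewrite mulmxE -exprS.
rewrite unitmx_mul; apply/andP; split.
  suff /mulmx1_unit[] :
    ((1%:M : 'M_p.+1) *t h 0) *m (1%:M *t invmx (h 0)) = 1%:M by [].
  by rewrite tensmx_mul mulmx1 mulmxV // tens1C.
apply: (@unitmx_addr_nilp _ _ p.+1).
rewrite mulmxE exprMn_comm; last exact/esym/toeplitz_comm.
by rewrite shift_toep tens_toep_expn -['X^_]mul1r toepMXn_eq0 // tens0mx mul0r.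
Qed.

Lemma Jgrp_comm_units : Jgrp F r p.+1 = comm_units S.
Proof.
apply/seteqP; split => [_ [h h0 ->]|X [uX /comm_toeplitz[h E]]].
  by split; [rewrite toeplitz_unit | exact: toeplitz_comm].
by exists h => //; rewrite -toeplitz_unit -E.
Qed.

End ShiftCentralizer.

(** * The normalizer of one Toeplitz block *)

Section Substitutions.
Variables (F : fieldType) (p : nat).
Implicit Types (c : nat -> F).

(** The cut-off is one degree above the last column index, so that c_1 is present even for 1 x 1
    matrices. *)
Definition subst_poly c : {poly F} := \sum_(1 <= k < p.+2) c k *: 'X^k.

Lemma coef_subst_poly c j : (j <= p.+1)%N ->
  (subst_poly c)`_j = if j == 0 then 0 else c j.
Proof.
move=> jp; rewrite coef_sum; under eq_bigr do rewrite coefZ coefXn.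
case: eqP => [-> | /eqP]; last rewrite -lt0n => j0.
  by rewrite big_nat big1 // => -[|k] //; rewrite mulr0.
rewrite (bigD1_seq j) ?iota_uniq ?mem_index_iota ?j0 //= eqxx mulr1.
by rewrite big1 ?addr0 // => k /negPf; rewrite eq_sym => ->; rewrite mulr0.
Qed.

Lemma mu_mxE c i j : mu_mx p.+1 c i j = (subst_poly c ^+ i)`_j.
Proof. by rewrite mxE (@mu_trunc _ _ _ _ p.+1) // ltnW. Qed.

Lemma subst_poly_mulX c : exists q, subst_poly c = q * 'X /\ q`_0 = c 1.
Proof.
have [|q E] := @dvd_Xn_coef _ 1 (subst_poly c).
  by case=> // _; rewrite coef_subst_poly.
exists q; split=> //; have := @coef_subst_poly c 1 isT.
by rewrite E coefMXn.
Qed.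

(** Row i of [mu_mx] holds the coefficients of c(T)^i, so multiplying a row by c(T) yields the next
    one. Below the last row comes c(T)^(p+1), which vanishes modulo T^(p+1). *)
Lemma shift_mu_mx c :
  shift_mx F p.+1 *m mu_mx p.+1 c = mu_mx p.+1 c *m toep p.+1 (subst_poly c).
Proof.
apply/matrixP => i j; rewrite [RHS]mxE; under eq_bigr do rewrite mu_mxE.
rewrite sum_coef_toep -exprSr.
have [ip|pi] := ltnP i.+1 p.+1.
  by rewrite (@shift_mulE _ _ _ _ _ (Ordinal ip)) // mu_mxE.
rewrite mxE big1 => [|k _]; last first.
  rewrite mxE; case: eqP => [E|_]; last by rewrite mul0r.
  by have := ltn_ord k; rewrite E ltnNge pi.
have [q [-> _]] := subst_poly_mulX c.
by rewrite exprMn coefMXn (leq_trans (ltn_ord j) pi).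
Qed.

(** As c(T)^i = T^i q(T)^i with q(0) = c_1, the matrix is upper triangular with diagonal entries
    c_1^i. *)
Lemma mu_mx_unit c : c 1 != 0 -> mu_mx p.+1 c \in unitmx.
Proof.
move=> c1; have [q [E q0]] := subst_poly_mulX c.
rewrite -unitmx_tr unitmxE det_trig.
  rewrite unitfE; apply/prodf_neq0 => i _; rewrite mxE mu_mxE E exprMn.
  by rewrite coefMXn ltnn subnn -horner_coef0 horner_exp horner_coef0 q0 expf_neq0.
apply/is_trig_mxP => i j ij; rewrite mxE mu_mxE E exprMn coefMXn.
by rewrite ij.
Qed.

End Substitutions.

Section ToeplitzNormalizer.
Variables (F : fieldType) (p r : nat).
Hypothesis natF_inj : injective (fun k : nat => k%:R : F).
Hypothesis r_gt0 : (0 < r)%N.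
Local Notation S := (shift_mx F p.+1 *t (1%:M : 'M[F]_r)).
Local Notation T1 f := (toep p.+1 f *t (1%:M : 'M[F]_r)).
Implicit Types A : 'M[F]_(p.+1 * r).

(** The inverse of A normalizes too, so A^-1 S A lies in the double centralizer and equals f(Lambda)
    (x) 1. Comparing nilpotency orders of S and f(Lambda) gives the conditions on f_0 and f_1. *)
Lemma conj_shift_subst A : normalizer (comm_units S) A ->
  exists2 c : nat -> F, c 1 != 0 & S *m A = A *m T1 (subst_poly p c).
Proof.
move=> NA; have [uA _] := NA.
have NA' := normalizer_comm_unitsV natF_inj NA.
have [f Ef] := shift_bicentralizer r_gt0 (normalizer_comm_units natF_inj NA').
have {Ef NA'} SA : S *m A = A *m T1 f.
  by rewrite -Ef invmxK !mulmxA mulmxV // mul1mx.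
have SkA k : T1 ('X^k) *m A = A *m T1 (f ^+ k).
  elim: k => [|k IH].
    by rewrite !expr0 -[X in toep _ X]polyC1 toepC tens1C mulmx1 mul1mx.
  rewrite !exprSr -!toepM -!tens1M -shift_toep -mulmxA SA mulmxA IH.
  by rewrite -mulmxA.
have toep0 g h : T1 g *m A = A *m T1 h -> T1 h = 0 <-> T1 g = 0.
  move=> E; split=> E0; move: E; rewrite E0 ?mul0mx ?mulmx0.
    by move/(congr1 (fun M => M *m invmx A)); rewrite mul0mx mulmxK.
  by move/(congr1 (fun M => invmx A *m M)); rewrite mulmx0 mulKmx.
have toepT0 g : T1 g = 0 <-> forall i, (i <= p)%N -> g`_i = 0.
  split=> [E i ip | E].
    have : toep p.+1 g = toep p.+1 0.
      by apply: (tens1_inj r_gt0); rewrite E toepC tens1C raddf0.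
    by move/toep_inj/(_ i ip); rewrite coef0.
  have -> : toep p.+1 g = toep p.+1 0 by apply/toep_inj => i ip; rewrite coef0 E.
  by rewrite toepC tens1C raddf0.
(* S^(p+1) = 0 forces f^(p+1) to vanish modulo T^(p+1), in particular its constant term. *)
have f0 : f`_0 = 0.
  suff /eqP : f`_0 ^+ p.+1 = 0 by rewrite expf_eq0 => /eqP.
  rewrite -horner_coef0 -horner_exp horner_coef0.
  apply: ((toepT0 _).1 _ 0) => //; apply/(toep0 _ _ (SkA p.+1)).
  by rewrite -['X^_]mul1r toepMXn_eq0 // tens0mx.
have f1 : (0 < p)%N -> f`_1 != 0.
  move=> p0; apply/eqP => f1.
  (* Otherwise T^(2p) divides f^p with 2p >= p + 1, making Lambda^p zero. *)
  have [[|[|]] // _|q E] := @dvd_Xn_coef _ 2 f.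
  have /toepT0/(_ p (leqnn p)) : T1 ('X^p) = 0; last first.
    by rewrite coefXn eqxx => /eqP; rewrite oner_eq0.
  apply/(toep0 _ _ (SkA p)); rewrite E exprMn -exprM toepMXn_eq0 ?tens0mx //.
  by rewrite mul2n -addnn -addn1 leq_add2l.
(* For p = 0 the shift is zero and says nothing about c_1, which is set to 1. *)
exists (fun k => if (p == 0) && (k == 1) then 1 else f`_k).
  by case: posnP => [_|/f1]; rewrite ?eqxx ?oner_eq0.
rewrite SA; congr (_ *m (_ *t _)); apply/toep_inj => i ip.
rewrite coef_subst_poly; last exact: ltnW.
case: i ip => [|i] ip; first by rewrite f0.
by case: (posnP p) ip => [E|//]; rewrite E.
Qed.

(** A matrix commuting with S commutes with c(Lambda) (x) 1, which conjugation by w (x) 1 takes back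
    to S. *)
Lemma Wgrp_subset_normalizer : Wgrp F r p.+1 `<=` normalizer (comm_units S).
Proof.
move=> _ [c c1 ->]; set A := mu_mx _ _ *t _.
have uA : A \in unitmx.
  by apply: tensmx_unit; rewrite ?unitmx1 ?mu_mx_unit -?lt0n.
have SA : S *m A = A *m T1 (subst_poly p c) by rewrite !tens1M shift_mu_mx.
split=> // h [uh hS]; split.
  by rewrite !unitmx_mul unitmx_inv uA uh.
have -> : S = A *m T1 (subst_poly p c) *m invmx A by rewrite -SA mulmxK.
by apply/comm_conj => //; apply: comm_shift_toep.
Qed.

(** A and w intertwine S with the same matrix c(Lambda) (x) 1, so A w^-1 commutes with S. *)
Lemma normalizer_subset_mulset :
  normalizer (comm_units S) `<=` mulset (comm_units S) (Wgrp F r p.+1).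
Proof.
move=> A NA; have [uA _] := NA; have [c c1 SA] := conj_shift_subst NA.
pose w := mu_mx p.+1 c *t (1%:M : 'M[F]_r).
have Ww : Wgrp F r p.+1 w by exists c.
have [uw _] := Wgrp_subset_normalizer Ww.
have Sw : S *m w = w *m T1 (subst_poly p c) by rewrite !tens1M shift_mu_mx.
exists (A *m invmx w), w; split => //; last by rewrite mulmxKV.
split; first by rewrite unitmx_mul unitmx_inv uA.
rewrite /comm_mx mulmxA SA -!mulmxA; congr (A *m _).
by rewrite -(mulKmx uw (T1 (subst_poly p c))) -Sw -!mulmxA mulmxV // mulmx1.
Qed.

(** Both conditions on the right pass to products and inverses, which avoids composing and inverting
    power series. Conversely, row 0 being the polynomial 1 makes row i equal to c(T)^i. *)
Lemma Wgrp_normalizerP A : Wgrp F r p.+1 A <->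
  normalizer (comm_units S) A /\
  exists2 w, A = w *t (1%:M : 'M_r) & row 0 w = delta_mx 0 0.
Proof.
split=> [WA | [NA [w E w0]]].
  split; first exact: Wgrp_subset_normalizer.
  have [c _ ->] := WA; exists (mu_mx p.+1 c) => //.
  by apply/rowP => j; rewrite mxE mu_mxE expr0 coef1 mxE.
have [c c1 SA] := conj_shift_subst NA; exists c => //; rewrite E.
congr (_ *t _); apply/matrixP => i j; rewrite mu_mxE.
have Sw : shift_mx F p.+1 *m w = w *m toep p.+1 (subst_poly p c).
  by apply: (tens1_inj r_gt0); rewrite -!tens1M -E.
rewrite (shift_intertwine Sw); suff -> : rVpoly (row 0 w) = 1 by rewrite mul1r.
by rewrite w0 rVpoly_delta.
Qed.

Lemma Wgrp_subgroup : is_subgroup (Wgrp F r p.+1).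
Proof.
have [sN N1 NM NV] := normalizer_comm_units_subgroup natF_inj S.
split.
- by move=> A /Wgrp_normalizerP[/sN].
- by apply/Wgrp_normalizerP; split=> //; exists 1%:M; rewrite ?tens1C ?row1.
- move=> A B /Wgrp_normalizerP[NA [a EA a0]] /Wgrp_normalizerP[NB [b EB b0]].
  apply/Wgrp_normalizerP; split; first exact: NM.
  by exists (a *m b); rewrite ?EA ?EB ?tens1M // row_mul a0 -rowE b0.
- move=> A WA; have [c c1 EA] := WA.
  have /Wgrp_normalizerP[NA [a EA' a0]] := WA.
  apply/Wgrp_normalizerP; split; first exact: NV.
  have ua : a \in unitmx.
    have -> : a = mu_mx p.+1 c by apply: (tens1_inj r_gt0); rewrite -EA.
    exact: mu_mx_unit.
  have AV : A *m (invmx a *t 1%:M) = 1%:M by rewrite EA' tens1M mulmxV // tens1C.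
  exists (invmx a).
    by rewrite -[LHS]mulmx1 -AV mulKmx //; apply: sN.
  by rewrite rowE -a0 -row_mul mulmxV // row1.
Qed.

Lemma comm_units_Wgrp_cap : comm_units S `&` Wgrp F r p.+1 = [set 1%:M].
Proof.
apply/seteqP; split=> [A [[uA AS] /Wgrp_normalizerP[_ [w E w0]]] | _ ->] /=.
  rewrite E; suff -> : w = 1%:M by rewrite tens1C.
  have Sw : shift_mx F p.+1 *m w = w *m toep p.+1 'X.
    by apply: (tens1_inj r_gt0); rewrite -shift_toep -!tens1M -E AS.
  apply/matrixP => i j; rewrite (shift_intertwine Sw) w0 rVpoly_delta mul1r.
  by rewrite mxE coefXn eq_sym.
split; last by have [] := Wgrp_subgroup.
by have [] := comm_units_subgroup S.
Qed.

End ToeplitzNormalizer.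

(** * Block diagonal matrices *)

Section Disjoint.
Variable F : fieldType.

Definition mx_disjoint d e (z : 'M[F]_d) (y : 'M[F]_e) : Prop :=
  forall X : 'M_(d, e), z *m X = X *m y -> X = 0.

(** X intertwines (z - a)^k = 0 with (y - a)^k, and y - a is invertible, being the nonzero scalar b
    - a plus a nilpotent. *)
Lemma nilp_disjoint d e (z : 'M[F]_d) (y : 'M[F]_e) (a b : F) k l :
  (z - a%:M) ^+ k = 0 -> (y - b%:M) ^+ l = 0 -> a != b -> mx_disjoint z y.
Proof.
move=> za yb ab X E.
have Em m : (z - a%:M) ^+ m *m X = X *m (y - a%:M) ^+ m.
  elim: m => [|m IH]; first by rewrite !expr0 mul1mx mulmx1.
  rewrite !exprSr -!mulmxE -mulmxA mulmxBl E -scalar_mxC -mulmxBr.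
  by rewrite [LHS]mulmxA IH -mulmxA.
have uy : y - a%:M \in unitmx.
  have -> : y - a%:M = (b - a)%:M *m (1%:M + (b - a)^-1%:M *m (y - b%:M)).
    rewrite mulmxDr mulmx1 mulmxA -scalar_mxM divff ?subr_eq0 1?eq_sym //.
    by rewrite mul1mx raddfB /= [RHS]addrC addrA subrK.
  rewrite unitmx_mul; apply/andP; split.
    by rewrite unitmxE det_scalar unitfE expf_neq0 // subr_eq0 eq_sym.
  apply: (@unitmx_addr_nilp _ _ _ l); rewrite mulmxE exprMn_comm ?yb ?mulr0 //.
  exact/esym/scalar_mxC.
have := Em k; rewrite za mul0mx => /esym.
have : (y - a%:M) ^+ k \in unitmx.
  elim: (k) => [|m IH]; first by rewrite expr0 unitmx1.
  by rewrite exprS -mulmxE unitmx_mul uy.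
move=> uk /(congr1 (fun M => M *m invmx ((y - a%:M) ^+ k))).
by rewrite mulmxK // mul0mx.
Qed.

End Disjoint.

Section BlockRows.
Variables (F : fieldType).

(** Blocks become products with projections and inclusions, so blocks of a nested decomposition are
    reached by composing these. *)
Definition block_row q (d : 'I_q -> nat) i : 'M[F]_(d i, \sum_i d i) :=
  submxcol 1%:M i.
Definition block_col q (d : 'I_q -> nat) i : 'M[F]_(\sum_i d i, d i) :=
  submxrow 1%:M i.

Lemma block_row_mul p q (d : 'I_p -> nat) (e : 'I_q -> nat)
    (A : 'M[F]_(\sum_i d i, \sum_j e j)) i j :
  block_row d i *m A *m block_col e j = submxblock A i j.
Proof. by rewrite submxcol_mul mul1mx mul_submxrow mulmx1 submxblockEv. Qed.

End BlockRows.
Arguments block_row {F q} d i.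
Arguments block_col {F q} d i.

Section BlockDiagonal.
Variables (F : fieldType) (q : nat) (d : 'I_q -> nat).
Implicit Types (X Y : forall i, 'M[F]_(d i)) (A : 'M[F]_(\sum_i d i)).

Lemma submxblock_mxdiag_neq X i j : i != j -> submxblock (mxdiag X) i j = 0.
Proof. by move=> /negPf ij; rewrite mxblockK ij. Qed.

Lemma mxdiag_submxblock A : (forall i j, i != j -> submxblock A i j = 0) ->
  A = \mxdiag_i submxblock A i i.
Proof.
move=> A0; apply/mxblockP => i j; have [<-|ij] := eqVneq i j.
  by rewrite submxblock_diag.
by rewrite submxblock_mxdiag_neq // A0.
Qed.

Lemma mulmxdiag X Y : mxdiag X *m mxdiag Y = \mxdiag_i (X i *m Y i).
Proof.
rewrite [mxdiag Y]/mxdiag mul_mxdiag_mxblock; apply/eq_mxblock => i j.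
by case: eqP => [<-|]; rewrite ?conform_mx_id ?mulmx0.
Qed.

Lemma mul_mxdiag_submxblock X A i j :
  submxblock (mxdiag X *m A) i j = X i *m submxblock A i j.
Proof. by rewrite -[A in LHS]submxblockK mul_mxdiag_mxblock mxblockK. Qed.

Lemma mul_submxblock_mxdiag A X i j :
  submxblock (A *m mxdiag X) i j = submxblock A i j *m X j.
Proof. by rewrite -[A in LHS]submxblockK mul_mxblock_mxdiag mxblockK. Qed.

Lemma mxdiag1 : \mxdiag_i (1%:M : 'M[F]_(d i)) = 1%:M.
Proof. exact: mxdiagZ. Qed.

Lemma unitmx_mxdiagP X : reflect (forall i, X i \in unitmx) (mxdiag X \in unitmx).
Proof.
apply: (iffP idP) => [u i | u].
  suff /mulmx1_unit[] : X i *m submxblock (invmx (mxdiag X)) i i = 1%:M by [].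
  by rewrite -mul_mxdiag_submxblock mulmxV // -mxdiag1 submxblock_diag.
suff /mulmx1_unit[] : mxdiag X *m \mxdiag_i invmx (X i) = 1%:M by [].
by rewrite mulmxdiag -mxdiag1; apply/eq_mxdiag => i; rewrite mulmxV.
Qed.

Lemma invmx_mxdiag X : (forall i, X i \in unitmx) ->
  invmx (mxdiag X) = \mxdiag_i invmx (X i).
Proof.
move=> u; have uX : mxdiag X \in unitmx by apply/unitmx_mxdiagP.
rewrite -[LHS]mulmx1; have <- : mxdiag X *m \mxdiag_i invmx (X i) = 1%:M.
  by rewrite mulmxdiag -mxdiag1; apply/eq_mxdiag => i; rewrite mulmxV.
by rewrite mulKmx.
Qed.

Lemma conj_mxdiag X Y : (forall i, X i \in unitmx) ->
  mxdiag X *m mxdiag Y *m invmx (mxdiag X) =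
  \mxdiag_i (X i *m Y i *m invmx (X i)).
Proof. by move=> u; rewrite invmx_mxdiag // !mulmxdiag. Qed.

Section DiagProd.
Implicit Types S T : forall i, set 'M[F]_(d i).

Lemma diag_prodE S X : diag_prod S (mxdiag X) <-> forall i, S i (X i).
Proof.
split=> [[Y SY /eq_mxdiagP E] i | SX]; last by exists X.
by rewrite E.
Qed.

Lemma diag_prod_subgroup S : (forall i, is_subgroup (S i)) ->
  is_subgroup (diag_prod S).
Proof.
move=> gS; split.
- by move=> _ [X SX ->]; apply/unitmx_mxdiagP => i; have [+ _ _ _] := gS i; apply.
- by rewrite -mxdiag1; apply/diag_prodE => i; have [] := gS i.
- move=> _ _ [X SX ->] [Y SY ->]; rewrite mulmxdiag; apply/diag_prodE => i.
  by have [_ _ + _] := gS i; apply.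
- move=> _ [X SX ->]; rewrite invmx_mxdiag => [|i]; last first.
    by have [+ _ _ _] := gS i; apply.
  by apply/diag_prodE => i; have [_ _ _ +] := gS i; apply.
Qed.

Lemma normalizer_diag_prod S X : (forall i, is_subgroup (S i)) ->
  normalizer (diag_prod S) (mxdiag X) <-> forall i, normalizer (S i) (X i).
Proof.
move=> gS; split=> [[/unitmx_mxdiagP u NX] i | NX].
  split; first exact: u.
  (* Test on [h] in position i with identity blocks elsewhere. *)
  move=> h Sh; pose Y := dfwith (fun j => 1%:M : 'M[F]_(d j)) h.
  have /NX : diag_prod S (mxdiag Y).
    apply/diag_prodE => j; rewrite /Y; case: dfwithP => // k _.
    by have [] := gS k.
  by rewrite conj_mxdiag // => /diag_prodE/(_ i); rewrite /Y dfwith_in.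
have u i : X i \in unitmx by case: (NX i).
split; first exact/unitmx_mxdiagP.
move=> _ [Y SY ->]; rewrite conj_mxdiag //; apply/diag_prodE => i.
exact: (NX i).2.
Qed.

Lemma diag_prod_normalizer S T : (forall i, is_subgroup (S i)) ->
  (forall i, T i `<=` normalizer (S i)) ->
  diag_prod T `<=` normalizer (diag_prod S).
Proof.
by move=> gS TS _ [X TX ->]; apply/normalizer_diag_prod => // i; apply: TS.
Qed.

Lemma diag_prod_cap1 S T : (forall i, S i `&` T i = [set 1%:M]) ->
  diag_prod S `&` diag_prod T = [set 1%:M].
Proof.
move=> ST; have ST1 i : (S i `&` T i) 1%:M by rewrite ST.
apply/seteqP; split=> [_ [[X SX ->] /diag_prodE TX] | _ ->] /=.
  rewrite -mxdiag1; apply/eq_mxdiag => i.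
  by have : (S i `&` T i) (X i) by []; rewrite ST.
by rewrite -mxdiag1; split; apply/diag_prodE => i; case: (ST1 i).
Qed.

(** An off-diagonal block of a commuting matrix intertwines two disjoint blocks, so it vanishes. *)
Lemma diag_prod_comm_units (z : forall i, 'M[F]_(d i)) :
  (forall i j, i != j -> mx_disjoint (z i) (z j)) ->
  diag_prod (fun i => comm_units (z i)) = comm_units (mxdiag z).
Proof.
move=> dz; apply/seteqP; split=> [_ [X zX ->] | A [uA Az]].
  split; first by apply/unitmx_mxdiagP => i; case: (zX i).
  by rewrite /comm_mx !mulmxdiag; apply/eq_mxdiag => i; case: (zX i).
have E i j : submxblock A i j *m z j = z i *m submxblock A i j.
  by rewrite -mul_mxdiag_submxblock -mul_submxblock_mxdiag Az.
have EA : A = \mxdiag_i submxblock A i i.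
  by apply: mxdiag_submxblock => i j /dz; apply; rewrite E.
rewrite EA; apply/diag_prodE => i; split; last exact: E.
by move: uA; rewrite [A in A \in _]EA => /unitmx_mxdiagP.
Qed.

End DiagProd.

Lemma block_row_col i : block_row d i *m block_col d i = 1%:M :> 'M[F]_(d i).
Proof.
by rewrite -[block_row d i]mulmx1 block_row_mul -mxdiag1 submxblock_diag.
Qed.

Lemma block_row_col0 i j : i != j ->
  block_row d i *m block_col d j = 0 :> 'M[F]_(d i, d j).
Proof.
move=> ij; rewrite -[block_row d i]mulmx1 block_row_mul -mxdiag1.
exact: submxblock_mxdiag_neq.
Qed.

Lemma sum_block_col_row :
  \sum_i block_col d i *m block_row d i = 1%:M :> 'M[F]_(\sum_i d i).
Proof. by rewrite -mul_mxrow_mxcol submxrowK submxcolK mulmx1. Qed.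

Lemma block_row_mxdiag i X : block_row d i *m mxdiag X = X i *m block_row d i.
Proof.
rewrite -[LHS]mulmx1 -[RHS]mulmx1 -sum_block_col_row !mulmx_sumr.
apply: eq_bigr => j _; rewrite !mulmxA block_row_mul; congr (_ *m _).
rewrite -(mulmxA (X i)); have [<-|ij] := eqVneq i j.
  by rewrite submxblock_diag block_row_col mulmx1.
by rewrite submxblock_mxdiag_neq // block_row_col0 // mulmx0.
Qed.

Lemma block_col_mxdiag i X : mxdiag X *m block_col d i = block_col d i *m X i.
Proof.
rewrite -[LHS]mul1mx -[RHS]mul1mx -sum_block_col_row !mulmx_suml.
apply: eq_bigr => j _; rewrite -!mulmxA; congr (_ *m _).
rewrite !mulmxA block_row_mul; have [->|ij] := eqVneq j i.
  by rewrite submxblock_diag block_row_col mul1mx.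
by rewrite submxblock_mxdiag_neq // block_row_col0 // mul0mx.
Qed.

End BlockDiagonal.

Lemma mx_disjoint_mxdiag (F : fieldType) p q (d : 'I_p -> nat) (e : 'I_q -> nat)
    (z : forall i, 'M[F]_(d i)) (y : forall j, 'M[F]_(e j)) :
  (forall i j, mx_disjoint (z i) (y j)) -> mx_disjoint (mxdiag z) (mxdiag y).
Proof.
move=> zy X E; rewrite -[X]submxblockK -[RHS]mxblock0; apply/eq_mxblock => i j.
apply: zy; move: E; rewrite -[X in X = _]submxblockK.
rewrite -[in RHS](submxblockK (_ *m _)).
rewrite -{1 2}[X]submxblockK mul_mxdiag_mxblock mul_mxblock_mxdiag.
by rewrite !submxblockK => /eq_mxblockP.
Qed.

(** * Normalizers permute the blocks *)

Section BlockPattern.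
Variables (F : fieldType) (K : finType) (N : nat) (d : K -> nat).
Variables (u : forall k, 'M[F]_(d k, N)) (v : forall k, 'M[F]_(N, d k)).
Hypothesis uv1 : forall k, u k *m v k = 1%:M.
Hypothesis vu1 : \sum_k v k *m u k = 1%:M.
Hypothesis d_gt0 : forall k, (0 < d k)%N.

Lemma scalar_mx1_neq0 m : (0 < m)%N -> (1%:M : 'M[F]_m) != 0.
Proof. by rewrite -mxrank_eq0 mxrank1 lt0n. Qed.

(* If g intertwines two block diagonal matrices, each of whose blocks has a
   single eigenvalue, and the eigenvalues alpha are distinct, then every block
   row of g has at most one nonzero block; invertibility does the rest. *)
Lemma intertwiner_block_pattern (g z z' : 'M[F]_N)
    (Z Z' : forall k, 'M[F]_(d k)) (alpha beta : K -> F) (m m' : K -> nat) :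
  g \in unitmx -> g *m z = z' *m g -> injective alpha ->
  (forall k, z *m v k = v k *m Z k) ->
  (forall k, u k *m z' = Z' k *m u k) ->
  (forall k, (Z k - (alpha k)%:M) ^+ m k = 0) ->
  (forall k, (Z' k - (beta k)%:M) ^+ m' k = 0) ->
  exists t : {perm K}, forall k,
    d (t k) = d k /\ forall l, l != t k -> u k *m g *m v l = 0.
Proof.
move=> ug gz inj_alpha zv uz' nZ nZ'.
have row_exp k : u k *m g = \sum_l u k *m g *m v l *m u l.
  rewrite -[LHS]mulmx1 -vu1 mulmx_sumr; apply: eq_bigr => l _.
  by rewrite !mulmxA.
have col_exp l : g *m v l = \sum_k v k *m (u k *m g *m v l).
  rewrite -[LHS]mul1mx -vu1 mulmx_suml; apply: eq_bigr => k _.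
  by rewrite !mulmxA.
have blk0 k l : beta k != alpha l -> u k *m g *m v l = 0.
  move=> ba; apply: (nilp_disjoint (nZ' k) (nZ l) ba).
  by rewrite -[RHS]mulmxA -zv [RHS]mulmxA -(mulmxA _ g z) gz !mulmxA uz'.
have /fin_all_exists[f f0] k :
    exists j, forall l, l != j -> u k *m g *m v l = 0.
  have [l nz] : exists l, u k *m g *m v l != 0.
    apply/existsP; apply: contraT => /existsPn nz.
    have ug0 : u k *m g = 0.
      rewrite row_exp big1 // => l _.
      by move: (nz l); rewrite negbK => /eqP ->; rewrite mul0mx.
    have := scalar_mx1_neq0 (d_gt0 k).
    by rewrite -uv1 -[u k](mulmxK ug) ug0 !mul0mx eqxx.
  exists l => l' ll'; apply: (blk0); apply: contraNneq ll' => bl'.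
  have [bl|/blk0 bl] := eqVneq (beta k) (alpha l); last by rewrite bl eqxx in nz.
  by apply/eqP/inj_alpha; rewrite -bl.
have rowE k : u k *m g = u k *m g *m v (f k) *m u (f k).
  rewrite [LHS]row_exp (bigD1 (f k)) //= big1 ?addr0 // => l /f0 ->.
  by rewrite mul0mx.
(* If [f] missed l, block column l of g would be zero; surjectivity on a finite type then gives
   injectivity. *)
have f_onto l : l \in codom f.
  apply/negPn/negP => nl; have := scalar_mx1_neq0 (d_gt0 l).
  rewrite -uv1 -[v l](mulKmx ug) col_exp big1 ?mulmx0 ?eqxx // => k _.
  by rewrite f0 ?mulmx0 //; apply: contraNneq nl => ->; apply: codom_f.
have f_inj : injective f.
  have /image_injP f_inj : #|[seq f x | x in K]| == #|K|.
    by apply/eqP/eq_card => l; rewrite f_onto.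
  by move=> k k'; apply: f_inj.
exists (perm f_inj) => k; rewrite permE; split=> [|l]; last exact: f0.
apply/eqP; rewrite eqn_leq; apply/andP; split.
  (* This block column has full rank and factors through block k, so d (f k) <= d k; the block row
     gives the reverse. *)
  have colE : g *m v (f k) = v k *m (u k *m g *m v (f k)).
    rewrite [LHS]col_exp (bigD1 k) //= big1 ?addr0 // => k' kk'.
    by rewrite f0 ?mulmx0 // (inj_eq f_inj) eq_sym.
  have /eqP <- : row_full (g *m v (f k)).
    by apply/row_fullP; exists (u (f k) *m invmx g); rewrite mulmxA mulmxKV.
  by rewrite colE mulmx_max_rank.
have /eqP <- : row_free (u k *m g).
  by apply/row_freeP; exists (invmx g *m v k); rewrite mulmxA mulmxK.
by rewrite rowE mulmx_max_rank.
Qed.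

End BlockPattern.

Section NormalizerPattern.
Variables (F : fieldType) (K : finType) (N r : nat) (p : K -> nat).
Hypothesis natF_inj : injective (fun k : nat => k%:R : F).
Hypothesis r_gt0 : (0 < r)%N.
Hypothesis p_gt0 : forall k, (0 < p k)%N.
Variables (u : forall k, 'M[F]_(p k * r, N)) (v : forall k, 'M[F]_(N, p k * r)).
Hypothesis uv1 : forall k, u k *m v k = 1%:M.
Hypothesis vu1 : \sum_k v k *m u k = 1%:M.

(* The parameter a separates blocks: a block diagonal matrix made of such blocks
   with distinct a has exactly the algebra spanned by H_lambda as centralizer. *)
Definition spec_block q (a : F) : 'M[F]_(q * r) := shift_mx F q *t 1%:M + a%:M.

Lemma comm_spec_block q (a : F) X :
  comm_mx X (spec_block q a) <-> comm_mx X (shift_mx F q *t 1%:M).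
Proof.
rewrite /comm_mx mulmxDr mulmxDl scalar_mxC; split=> [|-> //].
exact: addIr.
Qed.

Lemma spec_block_nilp q (a : F) : (spec_block q a - a%:M) ^+ q = 0.
Proof.
rewrite addrK shift_toep tens_toep_expn -['X^_]mul1r toepMXn_eq0 //.
by rewrite tens0mx.
Qed.

(** z' = g z g^-1 commutes with all that commutes with z: with the block projections, so it is block
    diagonal, and inside a block with all that commutes with the shift, so each block has a single
    eigenvalue. *)
Lemma normalizer_block_pattern (alpha : K -> F) (z g : 'M[F]_N) :
  injective alpha ->
  (forall k, z *m v k = v k *m spec_block (p k) (alpha k)) ->
  (forall k, u k *m z = spec_block (p k) (alpha k) *m u k) ->
  normalizer (comm_units z) g ->
  exists t : {perm K}, forall k,
    p (t k) = p k /\ forall l, l != t k -> u k *m g *m v l = 0.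
Proof.
move=> inj_alpha zv uz Ng; have [ug _] := Ng.
have cz := normalizer_comm_units natF_inj Ng.
have [z' gz {}cz] : exists2 z', g *m z = z' *m g &
    forall y, comm_mx y z -> comm_mx y z'.
  by exists (g *m z *m invmx g) => //; rewrite mulmxKV.
have uz' k : u k *m z' = u k *m z' *m v k *m u k.
  have : comm_mx (v k *m u k) z by rewrite /comm_mx -mulmxA uz mulmxA -zv !mulmxA.
  move/cz; rewrite /comm_mx => E.
  by rewrite -[LHS]mul1mx -(uv1 k) -!mulmxA [v k *m _]mulmxA E !mulmxA.
have /fin_all_exists[beta nZ'] k :
    exists b : F, (u k *m z' *m v k - b%:M) ^+ p k = 0.
  have [f ->] : exists f, u k *m z' *m v k = toep (p k) f *t 1%:M.
    have cZ Y : comm_mx Y (shift_mx F (p k) *t 1%:M) ->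
        comm_mx Y (u k *m z' *m v k).
      move=> /(comm_spec_block (alpha k)) YZ.
      have /cz : comm_mx (v k *m Y *m u k) z.
        rewrite /comm_mx !mulmxA zv -!mulmxA uz; congr (_ *m _).
        by rewrite !mulmxA YZ.
      move=> /(congr1 (fun M => u k *m M *m v k)).
      rewrite !mulmxA uv1 mul1mx -!mulmxA uv1 mulmx1 => E.
      by move: E; rewrite /comm_mx !mulmxA.
    move: (u k *m z' *m v k) cZ; have := p_gt0 k.
    by case: (p k) => // q _ Z; apply: shift_bicentralizer.
  by exists f`_0; apply: tens_toep_nilp.
have d_gt0 k : (0 < p k * r)%N by rewrite muln_gt0 p_gt0.
have [t tP] := intertwiner_block_pattern uv1 vu1 d_gt0 ug gz inj_alpha zv uz'
  (fun k => spec_block_nilp _ _) nZ'.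
exists t => k; have [/eqP dk t0] := tP k; split=> //.
by apply/eqP; rewrite eqn_pmul2r in dk.
Qed.

End NormalizerPattern.

(** * Permutations of equal blocks *)

Section BlockPermutations.
Variables (F : fieldType) (d q : nat).
Implicit Types (s t : 'S_q) (X : 'I_q -> 'M[F]_d).
Local Notation P := (@block_perm_mx F d q).

Lemma mul_submxblock_perm (A : 'M[F]_(\sum_(k < q) d)) s k l :
  submxblock (A *m P s) k l = submxblock A k (s l).
Proof.
rewrite -[A in LHS]submxblockK mul_mxblock mxblockK (bigD1 (s l)) //= eqxx mulmx1.
by rewrite big1 ?addr0 // => m /negPf ->; rewrite raddf0 mulmx0.
Qed.

Lemma block_perm_mxM s t : P s *m P t = P (t * s)%g.
Proof.
by apply/mxblockP => k l; rewrite mul_submxblock_perm !mxblockK permM.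
Qed.

Lemma block_perm_mx1 : P 1%g = 1%:M.
Proof.
rewrite -(mxdiag1 _ (fun _ : 'I_q => d)); apply/eq_mxblock => k l.
by rewrite perm1 conform_mx_id; case: eqP => // _; rewrite raddf0.
Qed.

Lemma block_perm_mx_mulV s : P s *m P s^-1%g = 1%:M.
Proof. by rewrite block_perm_mxM mulVg block_perm_mx1. Qed.

Lemma block_perm_mx_unit s : P s \in unitmx.
Proof. by case/mulmx1_unit: (block_perm_mx_mulV s). Qed.

Lemma invmx_block_perm s : invmx (P s) = P s^-1%g.
Proof.
by rewrite -[LHS]mulmx1 -(block_perm_mx_mulV s) mulKmx ?block_perm_mx_unit.
Qed.

Lemma mxdiag_mul_perm X s : mxdiag X *m P s = P s *m \mxdiag_k X (s k).
Proof.
apply/mxblockP => k l; rewrite mul_submxblock_perm.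
rewrite [RHS]mul_submxblock_mxdiag [block_perm_mx _ _ _]/block_perm_mx.
have [->|ks] := eqVneq k (s l).
  by rewrite submxblock_diag mxblockK eqxx mul1mx.
by rewrite submxblock_mxdiag_neq // mxblockK (negPf ks) raddf0 mul0mx.
Qed.

Lemma conj_mxdiag_perm X s :
  invmx (P s) *m mxdiag X *m P s = \mxdiag_k X (s k).
Proof. by rewrite -mulmxA mxdiag_mul_perm mulKmx ?block_perm_mx_unit. Qed.

Lemma block_perms_subgroup : is_subgroup (block_perms F d q).
Proof.
split.
- by move=> _ [s _ <-]; apply: block_perm_mx_unit.
- by exists 1%g => //; apply: block_perm_mx1.
- by move=> _ _ [s _ <-] [t _ <-]; exists (t * s)%g; rewrite ?block_perm_mxM.
- by move=> _ [s _ <-]; exists s^-1%g; rewrite ?invmx_block_perm.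
Qed.

Lemma block_perms_normalizer (S : set 'M[F]_d) :
  block_perms F d q `<=` normalizer (diag_pow q S).
Proof.
move=> _ [s _ <-]; split=> [|_ [X SX ->]]; first exact: block_perm_mx_unit.
rewrite -[P s]invmxK invmx_block_perm invmx_block_perm.
have -> : P s^-1^-1%g *m mxdiag X *m invmx (P s^-1^-1)%g = \mxdiag_k X (s^-1%g k).
  by rewrite invgK invmx_block_perm -conj_mxdiag_perm invmx_block_perm invgK.
by apply/diag_prodE => k; apply: SX.
Qed.

Hypothesis d_gt0 : (0 < d)%N.

Lemma block_perm_mx_inj : injective P.
Proof.
move=> s t /mxblockP E; apply/permP => k; have := E (s k) k.
rewrite !mxblockK eqxx; case: eqP => // _ /eqP.
by rewrite raddf0 (negPf (scalar_mx1_neq0 _ d_gt0)).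
Qed.

Lemma block_perm_mx_mxdiag X s : P s = mxdiag X -> s = 1%g.
Proof.
move=> E; apply/permP => k; rewrite perm1; apply/eqP/negPn/negP => sk.
have /eqP := congr1 (fun M => submxblock M (s k) k) E.
rewrite submxblock_mxdiag_neq // mxblockK eqxx.
by rewrite (negPf (scalar_mx1_neq0 _ d_gt0)).
Qed.

Lemma diag_pow_perms_cap (S : set 'M[F]_d) : is_subgroup S ->
  diag_pow q S `&` block_perms F d q = [set 1%:M].
Proof.
move=> gS; apply/seteqP; split=> [A [[X SX ->] [s _ E]] | _ ->] /=.
  by rewrite -E (block_perm_mx_mxdiag E) block_perm_mx1.
split; last by have [] := block_perms_subgroup.
by have [] := @diag_prod_subgroup _ _ _ (fun _ : 'I_q => S) (fun=> gS).
Qed.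

Lemma block_perms_sym : isomorphic_to_Sym q (block_perms F d q).
Proof.
(* In ['S_q] the left factor acts first, so [P] reverses products; inversion corrects this. *)
exists (fun s => P s^-1%g); split.
- by move=> s t /block_perm_mx_inj/invg_inj.
- by move=> s t; rewrite block_perm_mxM invMg.
- apply/seteqP; split=> [_ [s _ <-]|_ [s _ <-]]; first by exists s^-1%g.
  by exists s^-1%g; rewrite ?invgK.
Qed.

End BlockPermutations.

(** * The normalizer for several blocks of one size *)

Section EqualBlocks.
Variables (F : fieldType) (r p : nat).
Hypothesis natF_inj : injective (fun k : nat => k%:R : F).
Hypothesis r_gt0 : (0 < r)%N.
Hypothesis p_gt0 : (0 < p)%N.
Local Notation J := (Jgrp F r p).
Local Notation W := (Wgrp F r p).

Lemma Jgrp_spec_block a : J = comm_units (spec_block r p a).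
Proof.
have -> : J = comm_units (shift_mx F p *t (1%:M : 'M_r)).
  by move: p_gt0; case: p => // m _; apply: Jgrp_comm_units.
by apply/seteqP; split=> A [uA /comm_spec_block AS].
Qed.

Lemma Jgrp_subgroup : is_subgroup J.
Proof. rewrite (Jgrp_spec_block 0); exact: comm_units_subgroup. Qed.

Lemma Wgrp_subgroup_gt0 : is_subgroup W.
Proof. by move: p_gt0; case: p => // m _; apply: Wgrp_subgroup. Qed.

Lemma Wgrp_normalizer : W `<=` normalizer J.
Proof.
move: p_gt0; case: p => // m _; rewrite Jgrp_comm_units.
exact: Wgrp_subset_normalizer.
Qed.

Lemma normalizer_Jgrp : normalizer J `<=` mulset J W.
Proof.
move: p_gt0; case: p => // m _; rewrite Jgrp_comm_units.
exact: normalizer_subset_mulset.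
Qed.

Lemma Jgrp_Wgrp_cap : J `&` W = [set 1%:M].
Proof.
move: p_gt0; case: p => // m _; rewrite Jgrp_comm_units.
exact: comm_units_Wgrp_cap.
Qed.

Variable q : nat.
Local Notation Jq := (diag_pow q J).
Local Notation Wq := (diag_pow q W).
Local Notation Pq := (block_perms F (p * r) q).

Lemma spec_block_disjoint p1 p2 (a b : F) : a != b ->
  mx_disjoint (spec_block r p1 a) (spec_block r p2 b).
Proof. exact: nilp_disjoint (spec_block_nilp _ _ _) (spec_block_nilp _ _ _). Qed.

(** Equal copies of Lambda (x) 1 have nonzero intertwiners. Adding distinct scalars excludes these
    and leaves the centralizer of each block unchanged. *)
Lemma diag_pow_Jgrp (a : 'I_q -> F) : injective a ->
  Jq = comm_units (\mxdiag_k spec_block r p (a k)).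
Proof.
move=> inj_a; rewrite -diag_prod_comm_units => [|k l kl]; last first.
  by apply: spec_block_disjoint; rewrite (inj_eq inj_a).
by apply/seteqP; split=> _ [X JX ->]; exists X => // k; have := JX k;
  rewrite (Jgrp_spec_block (a k)).
Qed.

Lemma diag_pow_Jgrp_subgroup : is_subgroup Jq.
Proof. apply: diag_prod_subgroup => k; exact: Jgrp_subgroup. Qed.

Lemma diag_pow_Wgrp_subgroup : is_subgroup Wq.
Proof. apply: diag_prod_subgroup => k; exact: Wgrp_subgroup_gt0. Qed.

Lemma Wgrp_perms_subgroup : is_subgroup (mulset Wq Pq).
Proof.
apply: mulset_subgroup; [exact: diag_pow_Wgrp_subgroup | exact: block_perms_subgroup |].
exact: block_perms_normalizer.
Qed.

Lemma Wgrp_perms_normalizer : mulset Wq Pq `<=` normalizer Jq.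
Proof.
move=> _ [w [s [Ww Ps ->]]]; apply: normalizerM.
  move: Ww; apply: diag_prod_normalizer => k; first exact: Jgrp_subgroup.
  exact: Wgrp_normalizer.
exact: block_perms_normalizer.
Qed.

Let d_gt0 : (0 < p * r)%N. Proof. by rewrite muln_gt0 p_gt0. Qed.

Lemma diag_pow_Jgrp_cap : Jq `&` mulset Wq Pq = [set 1%:M].
Proof.
apply/seteqP; split=> [A [[X JX ->] [_ [_ [[Y WY ->] [s _ <-] E]]]] | _ ->] /=;
  last first.
  by split; [have [] := diag_pow_Jgrp_subgroup | have [] := Wgrp_perms_subgroup].
have uY : mxdiag Y \in unitmx by have [+ _ _ _] := diag_pow_Wgrp_subgroup; apply; exists Y.
(* P_s = Y^-1 X is block diagonal, hence trivial. *)
have s1 : s = 1%g.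
  apply: (@block_perm_mx_mxdiag F _ _ d_gt0 (fun k => invmx (Y k) *m X k)).
  rewrite -mulmxdiag -invmx_mxdiag; last exact/unitmx_mxdiagP.
  by rewrite E mulKmx.
have XY : mxdiag X = mxdiag Y by rewrite E s1 block_perm_mx1 mulmx1.
have : (Jq `&` Wq) (mxdiag X) by split; [exists X | exists Y].
by rewrite diag_prod_cap1 // => k; apply: Jgrp_Wgrp_cap.
Qed.

Lemma normalizer_diag_pow_Jgrp : normalizer Jq `<=` mulset Jq (mulset Wq Pq).
Proof.
move=> g Ng; pose a (k : 'I_q) : F := (k : nat)%:R.
have inj_a : injective a by move=> k l /natF_inj/val_inj.
pose d (_ : 'I_q) := (p * r)%N.
have [t tP] : exists t : {perm 'I_q}, forall k : 'I_q,
    p = p /\ forall l, l != t k -> block_row d k *m g *m block_col d l = 0.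
  have Ng' := Ng; rewrite (diag_pow_Jgrp inj_a) in Ng'.
  apply: (normalizer_block_pattern natF_inj r_gt0 (p := fun=> p)
            _ _ _ inj_a _ _ Ng') => //.
  - exact: block_row_col.
  - exact: sum_block_col_row.
  - by move=> k; apply: block_col_mxdiag.
  - by move=> k; apply: block_row_mxdiag.
have NP (s : 'S_q) : normalizer Jq (block_perm_mx F (p * r) s).
  by apply: block_perms_normalizer; exists s.
(* Block row k of g is supported in column t k, and P_t moves that column to position k. *)
pose D := g *m block_perm_mx F (p * r) t.
have ED : D = \mxdiag_k submxblock D k k.
  apply: mxdiag_submxblock => k l kl; rewrite mul_submxblock_perm -block_row_mul.
  by have [_] := tP k; apply; rewrite (inj_eq perm_inj) eq_sym.
have : normalizer Jq D by apply: normalizerM.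
rewrite ED => /normalizer_diag_prod ND.
have {}ND k : mulset J W (submxblock D k k).
  by apply/normalizer_Jgrp/ND => l; apply: Jgrp_subgroup.
have /fin_all_exists[h /fin_all_exists[w hw]] k := ND k.
exists (mxdiag h), (mxdiag w *m block_perm_mx F (p * r) t^-1%g); split.
- by exists h => // k; case: (hw k).
- exists (mxdiag w), (block_perm_mx F (p * r) t^-1%g); split=> //.
    by exists w => // k; case: (hw k).
  by exists t^-1%g.
- rewrite mulmxA mulmxdiag.
  have <- : D = \mxdiag_k (h k *m w k).
    by rewrite ED; apply/eq_mxdiag => k; case: (hw k).
  by rewrite -mulmxA block_perm_mx_mulV mulmx1.
Qed.

End EqualBlocks.

(** * The normalizer of a general H_lambda *)

Lemma submxblock_eq0 (F : fieldType) m n (d : 'I_m -> nat) (e : 'I_n -> nat)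
    (A : 'M[F]_(\sum_i d i, \sum_j e j)) :
  (forall i j, submxblock A i j = 0) -> A = 0.
Proof.
by move=> A0; rewrite -[A]submxblockK -[RHS]mxblock0; apply/eq_mxblock.
Qed.

Lemma part_inj n (la : partition_of n) : injective (part la).
Proof.
move=> i j pij; case: (ltngtP i j) => [||/val_inj //] /(@part_decr _ la);
  by rewrite pij ltnn.
Qed.

Section PartitionNormalizer.
Variables (F : fieldType) (r n : nat) (la : partition_of n).
Hypothesis natF_inj : injective (fun k : nat => k%:R : F).
Hypothesis r_gt0 : (0 < r)%N.
Local Notation Jq := (fun i => diag_pow (mult la i) (Jgrp F r (part la i))).
Local Notation WP := (fun i => mulset (Wpow F r la i) (Pgrp F r la i)).

Lemma diag_prod_diag_pow_Jgrp (a : {i : 'I_(nparts la) & 'I_(mult la i)} -> F) :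
  injective a ->
  diag_prod Jq =
  comm_units (\mxdiag_i \mxdiag_k spec_block r (part la i) (a (Tagged _ k))).
Proof.
move=> inj_a; rewrite -diag_prod_comm_units => [|i j ij]; last first.
  apply: mx_disjoint_mxdiag => k l; apply: spec_block_disjoint.
  rewrite (inj_eq inj_a); apply: contraNneq ij => E.
  by have /(congr1 tag)/eqP := E.
have E i : diag_pow (mult la i) (Jgrp F r (part la i)) =
    comm_units (\mxdiag_k spec_block r (part la i) (a (Tagged _ k))).
  apply: diag_pow_Jgrp => [|k l /inj_a/eqP]; first exact: Defs.part_gt0.
  by rewrite eq_Tagged => /eqP.
by apply/seteqP; split=> _ [X JX ->]; exists X => // i; have := JX i; rewrite /= E.
Qed.

(** The single blocks, indexed by pairs (i, k), are permuted with their sizes preserved. The parts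
    n_i are distinct, so i is preserved. *)
Lemma normalizer_diag_prod_mxdiag g :
  normalizer (diag_prod Jq) g -> g = \mxdiag_i submxblock g i i.
Proof.
move=> Ng; pose K := {i : 'I_(nparts la) & 'I_(mult la i)}.
(* The rank in an enumeration of all pairs keeps the scalars distinct across different parts as
   well. *)
pose a (k : K) : F := (enum_rank k : nat)%:R.
have inj_a : injective a by move=> k l /natF_inj/val_inj/enum_rank_inj.
pose D i := (\sum_(k < mult la i) part la i * r)%N.
pose d i (_ : 'I_(mult la i)) := (part la i * r)%N.
pose u (k : K) : 'M[F]_(_, \sum_i D i) :=
  block_row (d (tag k)) (tagged k) *m block_row D (tag k).
pose v (k : K) : 'M[F]_(\sum_i D i, _) :=
  block_col D (tag k) *m block_col (d (tag k)) (tagged k).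
have [t tP] : exists t : {perm K}, forall k : K,
    part la (tag (t k)) = part la (tag k) /\
    forall l, l != t k -> u k *m g *m v l = 0.
  rewrite (diag_prod_diag_pow_Jgrp inj_a) in Ng.
  apply: (normalizer_block_pattern natF_inj r_gt0 (p := fun k : K => part la (tag k))
            _ _ _ inj_a _ _ Ng).
  - by move=> k; apply: Defs.part_gt0.
  - move=> k; rewrite /u /v -mulmxA [block_row _ _ *m (block_col _ _ *m _)]mulmxA.
    rewrite block_row_col mul1mx.
    exact: block_row_col.
  - pose vu (k : K) := v k *m u k.
    transitivity (\sum_(i < nparts la) \sum_(k < mult la i)
                    vu (Tagged (fun i => 'I_(mult la i)) k)).
      by rewrite [RHS]sig_big_dep /=; apply: eq_bigr => -[].
    rewrite -sum_block_col_row; apply: eq_bigr => i _ /=.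
    rewrite /vu /u /v /= -[block_row _ i in RHS]mul1mx -sum_block_col_row.
    rewrite mulmx_suml mulmx_sumr; apply: eq_bigr => k _; by rewrite !mulmxA.
  - case=> i k; rewrite /v mulmxA block_col_mxdiag -!mulmxA; congr (_ *m _).
    exact: block_col_mxdiag.
  - case=> i k; rewrite /u -mulmxA block_row_mxdiag !mulmxA; congr (_ *m _).
    exact: block_row_mxdiag.
apply: mxdiag_submxblock => i j ij; apply: submxblock_eq0 => k l.
rewrite -!block_row_mul !mulmxA.
have [/part_inj ti] := tP (Tagged _ k).
move=> /(_ (Tagged _ l)); rewrite /u /v /= !mulmxA; apply.
by apply: contraNneq ij => E; move: ti; rewrite -E /= => <-.
Qed.

(** Since g is block diagonal, it normalizes the product exactly when each block normalizes its
    factor; the factorizations of the blocks are then assembled. *)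
Lemma diag_prod_sdprod :
  is_sdprod (normalizer (diag_prod Jq)) (diag_prod Jq) (diag_prod WP).
Proof.
have gJ i : is_subgroup (Jq i) by apply: diag_pow_Jgrp_subgroup; apply: Defs.part_gt0.
have gWP i : is_subgroup (WP i) by apply: Wgrp_perms_subgroup; rewrite ?Defs.part_gt0.
have NWP i : WP i `<=` normalizer (Jq i).
  by apply: Wgrp_perms_normalizer; rewrite ?Defs.part_gt0.
suff -> : normalizer (diag_prod Jq) = mulset (diag_prod Jq) (diag_prod WP).
  apply: mulset_sdprod; [exact: diag_prod_subgroup | exact: diag_prod_subgroup | |].
    exact: diag_prod_normalizer.
  by apply: diag_prod_cap1 => i; apply: diag_pow_Jgrp_cap; rewrite ?Defs.part_gt0.
apply/seteqP; split=> [g Ng | _ [x [y [Jx WPy ->]]]]; last first.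
  apply: normalizerM; last by move: WPy; apply: diag_prod_normalizer.
  by move: Jx; apply: subgroup_normalizer; apply: diag_prod_subgroup.
have E := normalizer_diag_prod_mxdiag Ng; rewrite E in Ng.
have {}Ng i : mulset (Jq i) (WP i) (submxblock g i i).
  apply: normalizer_diag_pow_Jgrp; rewrite ?Defs.part_gt0 //.
  by move/normalizer_diag_prod: Ng; apply.
have /fin_all_exists[x /fin_all_exists[y xy]] i := Ng i.
exists (mxdiag x), (mxdiag y); split.
- by apply/diag_prodE => i; case: (xy i).
- by apply/diag_prodE => i; case: (xy i).
- by rewrite mulmxdiag E; apply/eq_mxdiag => i; case: (xy i).
Qed.

Lemma castmx_sdprod m m' (e : m = m') (K L : set 'M[F]_m) :
  is_sdprod (normalizer K) K L ->
  is_sdprod (normalizer [set castmx (e, e) A | A in K])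
    [set castmx (e, e) A | A in K] [set castmx (e, e) A | A in L].
Proof.
case: m' / e; suff E (A : set 'M[F]_m) : [set castmx (erefl, erefl) M | M in A] = A.
  by rewrite !E.
by rewrite -[RHS]image_id; apply: eq_imagel => M _; rewrite castmx_id.
Qed.

End PartitionNormalizer.

Theorem theorem3p7 (R : realType) (r n : nat) (la : partition_of n)
    (r_gt0 : (0 < r)%N) (n_gt0 : (0 < n)%N) :
  [/\ is_sdprod (normalizer (Hgrp R[i] r la)) (Hgrp R[i] r la) (Hcompl R[i] r la),
      (forall i : 'I_(nparts la),
         is_sdprod (mulset (Wpow R[i] r la i) (Pgrp R[i] r la i))
                   (Wpow R[i] r la i) (Pgrp R[i] r la i)),
      (forall i : 'I_(nparts la),
         isomorphic_to_Sym (mult la i) (Pgrp R[i] r la i)) &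
      (forall (i : 'I_(nparts la)) (s : 'S_(mult la i))
              (X : 'I_(mult la i) -> 'M[R[i]]_(part la i * r)),
         (forall k, Wgrp R[i] r (part la i) (X k)) ->
         let P := block_perm_mx R[i] (part la i * r) s in
         invmx P *m (\mxdiag_k X k) *m P = \mxdiag_k X (s k))].
Proof.
(* Characteristic zero of the complex numbers. *)
have natC_inj : injective (fun k : nat => k%:R : R[i]).
  exact: (Num.Theory.mulrIn (oner_neq0 R[i])).
have d_gt0 i : (0 < part la i * r)%N by rewrite muln_gt0 Defs.part_gt0.
split.
- exact/castmx_sdprod/diag_prod_sdprod.
- move=> i; have gW : is_subgroup (Wpow R[i] r la i).
    by apply: diag_pow_Wgrp_subgroup; rewrite ?Defs.part_gt0.
  apply: mulset_sdprod => //; first exact: block_perms_subgroup.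
    exact: block_perms_normalizer.
  apply: diag_pow_perms_cap => //.
  by apply: Wgrp_subgroup_gt0; rewrite ?Defs.part_gt0.
- by move=> i; apply: block_perms_sym.
- by move=> i s X _; apply: conj_mxdiag_perm.
Qed.
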